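(* Let $d\ge 1$ and $p\in[0,1]$ with $p_d=\frac{2d+1}{4d}<p\le 1$, let $(S_n)$ be the $d$-dimensional elephant random walk with memory parameter $p$ described in the context, let $a=\frac{2dp-1}{2d-1}$, and let $L$ be the almost sure limit of $n^{-a}S_n$ as $n\to\infty$ (this limit exists and $n^{-a}S_n\to L$ also in mean square). Then $\mathbb{E}[L]=0$ and $$\mathbb{E}[LL^T]=\frac{1}{d(2a-1)\Gamma(2a)}I_d;$$ in particular $$\mathbb{E}[\|L\|^2]=\frac{1}{(2a-1)\Gamma(2a)}.$$
   Context: Multi-dimensional elephant random walk (MERW). Fix a dimension $d\ge1$ and a memory parameter $p\in[0,1]$. Let $(e_1,\dots,e_d)$ be the standard basis of $\mathbb{R}^d$, $I_d$ the $d\times d$ identity matrix, and $J_d$ the $d\times d$ cyclic permutation matrix with entries $(J_d)_{i,i+1}=1$ for $1\le i\le d-1$, $(J_d)_{d,1}=1$, and all other entries $0$. Set $S_0=0$. The first step $X_1$ is uniformly distributed on $\{\pm e_1,\dots,\pm e_d\}$. For $n\ge1$, given $\mathcal{F}_n=\sigma(X_1,\dots,X_n)$, $X_{n+1}=A_nX_{b_n}$, where $b_n$ is uniform on $\{1,\dots,n\}$ and $A_n$ is a random matrix, with $b_n$, $A_n$ independent of each other and of $\mathcal{F}_n$, equal to $I_d$ with probability $p$ and to each of $-I_d,\ \pm J_d,\dots,\pm J_d^{d-1}$ with probability $\frac{1-p}{2d-1}$. The position is $S_n=X_1+\dots+X_n$. $\Gamma$ is the Euler Gamma function. *)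

(* Defs.v *)
From HB Require Import structures.
From mathcomp Require Import all_boot all_order all_algebra.
From mathcomp Require Import all_classical all_reals all_analysis.
Set Implicit Arguments. Unset Strict Implicit. Unset Printing Implicit Defensive.
Import Order.TTheory GRing.Theory Num.Theory.
Import numFieldNormedType.Exports.
Local Open Scope classical_set_scope.
Local Open Scope ring_scope.

Definition Gamma (R : realType) (s : R) : R :=
  fine (\int[@lebesgue_measure R]_(t in `]0%R, +oo[%classic)
          ((t `^ (s - 1)) * expR (- t))%:E)%E.

Definition evec (R : realType) (d : nat) (i : 'I_d) : 'cV[R]_d :=
  \col_(k < d) (k == i)%:R.

Definition Jmat (R : realType) (d : nat) : 'M[R]_d :=
  \matrix_(i < d, j < d) ((j : nat) == (i.+1 %% d)%N)%:R.

Definition pmf_X1 (R : realType) (d : nat) (x : 'cV[R]_d) : R :=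
  if [exists i : 'I_d, (x == evec R i) || (x == - evec R i)]
  then (2 * d)%:R^-1 else 0.

Definition pmf_b (R : realType) (n k : nat) : R :=
  if (1 <= k <= n)%N then n%:R^-1 else 0.

(* the 2d-1 "non-identity" matrices  -I_d, +-J_d, ..., +-J_d^(d-1):
   Aother k = (-1)^(k mod 2) J_d^(k/2), for 1 <= k <= 2d-1 *)
Definition Aother (R : realType) (d : nat) (k : nat) : 'M[R]_d :=
  ((-1) ^+ (k %% 2)) *: (Jmat R d ^+ (k %/ 2)).

Definition pmf_A (R : realType) (d : nat) (p : R) (M : 'M[R]_d) : R :=
  if M == 1%:M then p
  else if [exists k : 'I_(2 * d), (0 < k)%N && (M == Aother R d k)]
       then (1 - p) / (2 * d - 1)%:R else 0.

(* (X_n)_{n>=1}, built from X_1, (b_n)_{n>=1}, (A_n)_{n>=1} on a probability space: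
   X_1, b_1, A_1, b_2, A_2, ... are mutually independent with the above laws
   (stated as: every finite initial joint law is the product law), and
   X_{n+1} = A_n X_{b_n}. *)
Definition is_MERW (R : realType) (d0 : measure_display) (T : measurableType d0)
  (P : probability T R) (d : nat) (p : R)
  (X : nat -> T -> 'cV[R]_d) (b : nat -> T -> nat) (A : nat -> T -> 'M[R]_d) : Prop :=
  [/\ (forall x, measurable [set w | X 1%N w = x]),
      (forall n k, measurable [set w | b n w = k]),
      (forall n M, measurable [set w | A n w = M]),
      (forall (N : nat) (x : 'cV[R]_d) (k : nat -> nat) (M : nat -> 'M[R]_d),
          P [set w | X 1%N w = x /\
                     (forall i, (1 <= i <= N)%N -> b i w = k i /\ A i w = M i)]
          = (pmf_X1 x * \prod_(1 <= i < N.+1) (pmf_b R i (k i) * pmf_A p (M i)))%:E) &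
      (forall (n : nat) w, (1 <= b n w <= n)%N -> X n.+1 w = A n w *m X (b n w) w)].

Definition Spos (R : realType) (T : Type) (d : nat) (X : nat -> T -> 'cV[R]_d)
  (n : nat) (w : T) : 'cV[R]_d :=
  \sum_(1 <= i < n.+1) X i w.

(* Main.v *)
(** The recursion gives [E[X_(n+1) | F_n] = (a / n) S_n] and [E[X_n X_n^T] = I / d], so
    [E[S_n] = 0], [E[S_m S_n^T] = (alpha_m / alpha_n) (v_n / d) I] for [n <= m], where
    [alpha_n = prod_(j < n) (1 + a / j)], [v_1 = 1] and [v_(n+1) = (1 + 2 a / n) v_n + 1].
    The latter recursion is solved by
    [v_n = n (prod_(j <= n) (1 + (2 a - 1) / j) - 1) / (2 a - 1)], and Gauss' product for
    Gamma yields the limits of [n^-a alpha_n] and [n^(-2a) v_n].  Hence [n^-a S_n] is Cauchy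
    in mean square; by Fatou it converges to the almost sure limit [L] in mean square, and
    the second moments of every affine form [c . L + t] are the limits of those of
    [c . n^-a S_n + t].  Polarization recovers [E[L L^T]], and, taking the constant [1] as
    second factor, [E[L]]. *)
Require Import Defs.
From HB Require Import structures.
From mathcomp Require Import all_boot all_order all_algebra.
From mathcomp Require Import all_classical all_reals all_analysis.
From mathcomp Require Import measurable_realfun zify ring lra.
Set Implicit Arguments.
Unset Strict Implicit.
Unset Printing Implicit Defensive.
Import Order.TTheory GRing.Theory Num.Theory.
Import numFieldNormedType.Exports.
Local Open Scope classical_set_scope.
Local Open Scope ring_scope.

(** * Gauss' product for the Gamma function *)

Section GammaFunction.
Variable R : realType.
Implicit Types s t x : R.
Local Notation mu := (@lebesgue_measure R).

(** With [u = t / (2 * s)], the bound [ln u <= u] gives [s * ln u <= t / 2], hence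
    [t^s e^(-t/2) <= (2 s)^s]. This yields an integrable majorant of the Gamma integrand. *)
Lemma powR_expR_bound s : 0 <= s ->
  exists2 C, 0 < C & forall t, 0 <= t -> t `^ s * expR (- t) <= C * expR (- (2^-1 * t)).
Proof.
rewrite le_eqVlt => /predU1P[<-|s0].
  exists 1 => // t t0; rewrite powRr0 !mul1r ler_expR; lra.
exists ((2 * s) `^ s); first by rewrite powR_gt0 ?mulr_gt0.
move=> t; rewrite le_eqVlt => /predU1P[<-|t0].
  by rewrite powR0 ?gt_eqF// mul0r mulr_ge0 ?powR_ge0 ?expR_ge0.
rewrite /powR !gt_eqF ?mulr_gt0// -!expRD ler_expR.
have k0 : 0 < 2 * s by rewrite mulr_gt0.
have -> : ln t = ln (t / (2 * s)) + ln (2 * s).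
  by rewrite ln_div ?posrE// subrK.
have h : ln (t / (2 * s)) <= t / (2 * s).
  by apply/ltW/ln_sublinear; rewrite divr_gt0.
have : s * ln (t / (2 * s)) <= 2^-1 * t.
  apply: (le_trans (ler_wpM2l (ltW s0) h)).
  rewrite (_ : s * _ = 2^-1 * t)//; field; rewrite gt_eqF//.
rewrite mulrDr; lra.
Qed.

Lemma within_continuous_powR s : 0 <= s ->
  {within `[0, +oo[, continuous (fun t : R => t `^ s)}.
Proof.
move=> s0; apply/continuous_within_itvcyP; split.
  move=> t; rewrite in_itv/= andbT => t0.
  apply: differentiable_continuous; apply/derivable1_diffP.
  by apply: derivable_powR; rewrite in_itv/= t0.
move: s0; rewrite le_eqVlt => /predU1P[<-|s0].
  by rewrite powRr0; under eq_fun do rewrite powRr0; exact: cvg_cst.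
by rewrite powR0 ?gt_eqF//; exact: powR_cvg0.
Qed.

Let cexpN (k : R) : continuous (fun t : R => expR (- (k * t))).
Proof.
move=> t; apply: continuous_comp; last exact: continuous_expR.
by apply: (@continuousN _ R^o); apply: continuousM => //; exact: cst_continuous.
Qed.

Let expN_y (k : R) : 0 < k -> expR (- (k * t)) @[t --> +oo%R] --> (0 : R).
Proof.
move=> k0; apply: (@cvg_comp _ _ _ (fun t => k * t) (fun z => expR (- z)) _ (pinfty_nbhs R)).
  exact: gt0_cvgMry.
exact: cvgr_expR.
Qed.

Let der_expN (k x : R) : is_derive x 1 (fun t : R => expR (- (k * t))) (- (k * expR (- (k * x)))).
Proof.
apply: is_derive_eq.
by rewrite /GRing.scale/=; ring.
Qed.

Lemma integral_expR_half (C : R) : 0 < C ->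
  (\int[mu]_(t in `[0%R, +oo[%classic) (C * expR (- (2^-1 * t)))%:E = (2 * C)%:E)%E.
Proof.
move=> C0.
rewrite (@ge0_continuous_FTC2y _ _ (fun t => - (2 * C) * expR (- (2^-1 * t))) _ 0).
- by rewrite mulr0 oppr0 expR0 mulr1 add0e EFinN oppeK.
- by move=> t _; rewrite mulr_ge0 ?expR_ge0 ?ltW.
- apply: continuous_subspaceT => t; apply: cvgM; first exact: cvg_cst.
  exact: cexpN.
- rewrite -[X in _ --> X](mulr0 (- (2 * C))); apply: cvgM; first exact: cvg_cst.
  by apply: expN_y; rewrite invr_gt0.
- by move=> x _; apply: derivableM => //; apply: ex_derive.
- apply: cvgM; first exact: cvg_cst.
  apply: cvg_at_right_filter; exact: cexpN.
- move=> x _; rewrite derive1E deriveM// ?derive_cst ?scaler0 ?addr0.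
  by rewrite derive_val /GRing.scale/=; field.
Qed.

Let mgamma s : 0 <= s ->
  measurable_fun (`[0, +oo[%classic : set R) (fun t : R => t `^ s * expR (- t)).
Proof.
move=> s0; apply: measurable_funM.
  by apply: subspace_continuous_measurable_fun => //; exact: within_continuous_powR.
apply: measurable_funTS; apply: measurableT_comp => //.
Qed.

(** [Gamma] is the [fine] part of an integral, so finiteness is at stake; the exponential majorant
    supplies it. The argument [1 + s] keeps the exponent nonnegative, so that the integrand is
    continuous up to [0]. *)
Lemma GammaE_cy s : 0 <= s ->
  (\int[mu]_(t in `[0%R, +oo[%classic) (t `^ s * expR (- t))%:E = (Gamma (1 + s))%:E)%E.
Proof.
move=> s0; rewrite /Gamma (addrC 1) addrK.
rewrite integral_itv_obnd_cbnd; last first.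
  apply/measurable_EFinP; apply: measurable_funS (mgamma s0) => //.
  by apply: subset_itvr; rewrite bnd_simp.
rewrite fineK// ge0_fin_numE; last first.
  by apply: integral_ge0 => t _; rewrite lee_fin mulr_ge0 ?powR_ge0 ?expR_ge0.
have [C C0 HC] := powR_expR_bound s0.
apply: (@le_lt_trans _ _ (2 * C)%:E); last exact: ltry.
rewrite -integral_expR_half//; apply: ge0_le_integral => //.
- by move=> t _; rewrite lee_fin mulr_ge0 ?powR_ge0 ?expR_ge0.
- by apply/measurable_EFinP; exact: mgamma.
- apply/measurable_EFinP; apply: measurable_funM => //.
  apply: measurable_funTS; apply: continuous_measurable_fun; exact: cexpN.
- by move=> t; rewrite /= in_itv/= andbT => t0; rewrite lee_fin HC.
Qed.

(* The derivative of [- t^s e^-t] changes sign, so a multiple of [e^(-t/2)] is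
   added to bring it within reach of the fundamental theorem for nonnegative
   integrands on a half-line. *)
Lemma GammaS s : 1 <= s -> Gamma (1 + s) = s * Gamma s.
Proof.
move=> s1.
have s0 : 0 <= s by lra.
have s10 : 0 <= s - 1 by lra.
have [C C0 HC] := powR_expR_bound s0.
have [C' C'0 HC'] := powR_expR_bound s10.
pose K := s * C'.
have K0 : 0 < K by rewrite mulr_gt0//; lra.
pose f t := t `^ s * expR (- t) - s * (t `^ (s - 1) * expR (- t)) + K * expR (- (2^-1 * t)).
have cexp1 : continuous (fun t : R => expR (- t)).
  by move=> t; have := @cexpN 1 t; under eq_fun do rewrite mul1r.
have f0 t : 0 <= t -> 0 <= f t.
  move=> t0; rewrite /f.
  have h1 : 0 <= t `^ s * expR (- t) by rewrite mulr_ge0 ?powR_ge0 ?expR_ge0.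
  have h2 : s * (t `^ (s - 1) * expR (- t)) <= K * expR (- (2^-1 * t)).
    by rewrite -mulrA ler_wpM2l// HC'.
  lra.
have cf : {within `[0, +oo[, continuous f}.
  move=> t; apply: cvgD; last first.
    apply: cvgM; first exact: cvg_cst.
    by have /(_ t) := continuous_subspaceT (A := (`[0, +oo[%classic : set R)) (@cexpN 2^-1); apply.
  apply: cvgB.
    apply: cvgM; first by have /(_ t) := within_continuous_powR s0; apply.
    by have /(_ t) := continuous_subspaceT (A := (`[0, +oo[%classic : set R)) cexp1; apply.
  apply: cvgM; first exact: cvg_cst.
  apply: cvgM; first by have /(_ t) := within_continuous_powR s10; apply.
  by have /(_ t) := continuous_subspaceT (A := (`[0, +oo[%classic : set R)) cexp1; apply.
have intf : (\int[mu]_(t in `[0%R, +oo[%classic) (f t)%:E = (2 * K)%:E)%E.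
  (* An antiderivative of [f] that vanishes at infinity: the integral is [- F 0 = 2 K]. *)
  pose F t := - (t `^ s * expR (- t)) - (2 * K) * expR (- (2^-1 * t)).
  have dF (x : R) : 0 < x -> is_derive x 1 F (f x).
    move=> x0; rewrite /F.
    have h1 := is_derive1_powR s x0.
    have h2 : is_derive x 1 (fun t => expR (- t)) (- expR (- x)).
      by have := der_expN 1 x; under eq_fun do rewrite mul1r; rewrite !mul1r.
    have h3 := der_expN 2^-1 x.
    apply: is_derive_eq.
    rewrite /GRing.scale/= /f; field.
    by [].
  transitivity (0%:E - (F 0)%:E)%E; first apply: ge0_continuous_FTC2y => //.
  - have -> : (0 : R) = - 0 - (2 * K) * 0 by rewrite mulr0 oppr0 addr0.
    apply: cvgB; last first.
      by apply: cvgM; [exact: cvg_cst | apply: expN_y; rewrite invr_gt0].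
    apply: cvgN.
    apply: (@squeeze_cvgr _ _ _ _ (fun=> 0) (fun t => C * expR (- (2^-1 * t)))).
    + near=> t; apply/andP; split; first by rewrite mulr_ge0 ?powR_ge0 ?expR_ge0.
      by apply: HC; near: t; apply: nbhs_pinfty_ge; rewrite num_real.
    + exact: cvg_cst.
    + rewrite -[X in _ --> X](mulr0 C); apply: cvgM; first exact: cvg_cst.
      by apply: expN_y; rewrite invr_gt0.
  - by move=> x x0; have [] := dF x x0.
  - apply: cvgB.
      apply: cvgN; apply: cvgM.
        by have /continuous_within_itvcyP[] := within_continuous_powR s0.
      by apply: cvg_at_right_filter; exact: cexp1.
    apply: cvgM; first exact: cvg_cst.
    by apply: cvg_at_right_filter; exact: cexpN.
  - move=> x; rewrite in_itv/= andbT => x0; rewrite derive1E.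
    by have [_ ->] := dF x x0.
  - rewrite /F powR0 ?mulr0 ?oppr0 ?expR0 ?mulr1 ?mul0r ?oppr0 ?add0r ?add0e.
      by rewrite EFinN oppeK.
    by rewrite gt_eqF//; lra.
have mf : measurable_fun (`[0, +oo[%classic : set R) f.
  exact: subspace_continuous_measurable_fun.
have mK : measurable_fun (`[0, +oo[%classic : set R) (fun t => K * expR (- (2^-1 * t))).
  apply: measurable_funM => //.
  by apply: measurable_funTS; apply: continuous_measurable_fun; exact: cexpN.
(* With the negative term of [f] moved to the other side, all terms are nonnegative, so the
   integrals add up and [2 K] cancels. *)
have : (\int[mu]_(t in `[0%R, +oo[%classic) ((f t)%:E + s%:E * (t `^ (s - 1) * expR (- t))%:E)
   = \int[mu]_(t in `[0%R, +oo[%classic) ((t `^ s * expR (- t))%:E + (K * expR (- (2^-1 * t)))%:E))%E.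
  apply: eq_integral => t _; rewrite -EFinM -!EFinD; congr EFin.
  by rewrite /f; ring.
rewrite ge0_integralD//=.
- rewrite [in RHS]ge0_integralD//=.
  + rewrite ge0_integralZl_EFin//=.
    * rewrite intf integral_expR_half// GammaE_cy// GammaE_cy//.
      by rewrite -EFinM -!EFinD subrKC => -[]; lra.
    * by move=> t _; rewrite lee_fin mulr_ge0 ?powR_ge0 ?expR_ge0.
    * by apply/measurable_EFinP; exact: mgamma.
  + by move=> t _; rewrite lee_fin mulr_ge0 ?powR_ge0 ?expR_ge0.
  + by apply/measurable_EFinP; exact: mgamma.
  + by move=> t _; rewrite lee_fin mulr_ge0 ?expR_ge0 ?ltW.
  + exact/measurable_EFinP.
- by move=> t; rewrite /= in_itv/= andbT => t0; rewrite lee_fin f0.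
- exact/measurable_EFinP.
- by move=> t _; rewrite -EFinM lee_fin mulr_ge0// mulr_ge0 ?powR_ge0 ?expR_ge0.
- apply: emeasurable_funM => //; apply/measurable_EFinP; exact: mgamma.
Unshelve. all: by end_near. Qed.

Lemma Gamma1 : Gamma (1 : R) = 1.
Proof.
have := GammaE_cy (lexx 0); rewrite addr0 => H.
have : (\int[mu]_(t in `[0%R, +oo[%classic) (t `^ 0 * expR (- t))%:E = 1%:E)%E.
  under eq_integral do rewrite powRr0 mul1r.
  rewrite (@ge0_continuous_FTC2y _ _ (fun t => - expR (- t)) _ 0).
  - by rewrite oppr0 expR0 add0e EFinN oppeK.
  - by move=> t _; rewrite expR_ge0.
  - apply: continuous_subspaceT => t.
    by have := @cexpN 1 t; under eq_fun do rewrite mul1r.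
  - rewrite -[X in _ --> X]oppr0; apply: cvgN.
    by have := expN_y ltr01; under eq_fun do rewrite mul1r.
  - by move=> x _.
  - apply: cvgN; apply: cvg_at_right_filter.
    by have := @cexpN 1 0; under eq_fun do rewrite mul1r.
  - move=> x _; rewrite derive1E derive_val /GRing.scale/=; ring.
by rewrite H => -[].
Qed.

Lemma Gamma_ge0 s : 0 <= Gamma s.
Proof.
apply: fine_ge0; apply: integral_ge0 => t _.
by rewrite lee_fin mulr_ge0 ?powR_ge0 ?expR_ge0.
Qed.

(** Young's inequality for the factors [u^x] and [1] with exponents [1/x] and [1/(1-x)]; the
    endpoints, where an exponent would be infinite, are treated apart. *)
Lemma powR_le_affine (u x : R) : 0 <= u -> 0 <= x <= 1 -> u `^ x <= 1 - x + x * u.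
Proof.
move=> u0 /andP[x0 x1].
have [->|xn0] := eqVneq x 0; first by rewrite powRr0 mul0r subr0 addr0.
have [->|xn1] := eqVneq x 1; first by rewrite powRr1// mul1r subrr add0r.
have xp : 0 < x by rewrite lt0r xn0.
have x1p : 0 < 1 - x by rewrite subr_gt0 lt_neqAle xn1.
have := @conjugate_powR R (u `^ x) 1 x^-1 (1 - x)^-1.
rewrite !invrK powR1 mulr1 mul1r -powRrM mulfV// powRr1//.
move=> /(_ (powR_ge0 _ _) ler01); rewrite !invr_gt0 => /(_ xp x1p).
rewrite addrC subrK => /(_ erefl); lra.
Qed.

(* Log-convexity of Gamma, in the form of the tangent inequality
   [(t/s)^x <= 1 - x + x t/s] integrated against [t^(s-1) e^-t]. *)
Lemma Gamma_add_le s x : 1 <= s -> 0 <= x <= 1 -> Gamma (s + x) <= s `^ x * Gamma s.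
Proof.
move=> s1 /[dup] x01 /andP[x0 x1].
have s0 : 0 < s by lra.
have s10 : 0 <= s - 1 by lra.
have sx0 : 0 <= s + x - 1 by lra.
(* [c1 + c2 t] is the tangent line to [t^x] at [t = s]; in particular [c1 + c2 s = s^x]. *)
pose c1 := s `^ x * (1 - x); pose c2 := s `^ x * x / s.
have c10 : 0 <= c1 by rewrite mulr_ge0 ?powR_ge0 ?subr_ge0.
have c20 : 0 <= c2 by rewrite !mulr_ge0 ?powR_ge0 ?invr_ge0// ltW.
have : ((Gamma (s + x))%:E <= c1%:E * (Gamma s)%:E + c2%:E * (Gamma (1 + s))%:E)%E.
  have -> : s + x = 1 + (s + x - 1) by ring.
  have -> : Gamma s = Gamma (1 + (s - 1)) by congr Gamma; ring.
  have -> : Gamma (1 + s) = Gamma (1 + (1 + (s - 1))) by congr Gamma; ring.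
  rewrite -!GammaE_cy; [|lra..].
  rewrite -!ge0_integralZl_EFin//; last first.
  - by apply/measurable_EFinP; exact: mgamma.
  - by move=> t _; rewrite lee_fin mulr_ge0 ?powR_ge0 ?expR_ge0.
  - by apply/measurable_EFinP; apply: mgamma; rewrite addrC subrK ltW.
  - by move=> t _; rewrite lee_fin mulr_ge0 ?powR_ge0 ?expR_ge0.
  have m1 : measurable_fun (`[0, +oo[%classic : set R) (fun t => c1%:E * (t `^ (s - 1) * expR (- t))%:E)%E.
    by apply: emeasurable_funM => //; apply/measurable_EFinP; exact: mgamma.
  have m2 : measurable_fun (`[0, +oo[%classic : set R)
      (fun t => c2%:E * (t `^ (1 + (s - 1)) * expR (- t))%:E)%E.
    apply: emeasurable_funM => //; apply/measurable_EFinP; apply: mgamma; lra.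
  rewrite -ge0_integralD//; last 2 first.
  - by move=> t _; rewrite -EFinM lee_fin mulr_ge0// mulr_ge0 ?powR_ge0 ?expR_ge0.
  - by move=> t _; rewrite -EFinM lee_fin mulr_ge0// mulr_ge0 ?powR_ge0 ?expR_ge0.
  apply: ge0_le_integral => //.
  - by move=> t _; rewrite lee_fin mulr_ge0 ?powR_ge0 ?expR_ge0.
  - by apply/measurable_EFinP; exact: mgamma.
  - exact: emeasurable_funD.
  - move=> t; rewrite /= in_itv/= andbT => t0.
    rewrite -!EFinM -EFinD lee_fin !mulrA -mulrDl ler_wpM2r ?expR_ge0//.
    (* At [t = 0] the convention [0^0 = 1] matters: for [x = 0] both sides agree, and for [x > 0]
       the exponent [s + x - 1] is positive, so the left side is [0]. *)
    move: t0; rewrite le_eqVlt => /predU1P[<-|t0].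
      have [x00|xn0] := eqVneq x 0.
        by rewrite /c1 /c2 x00 !powRr0 subr0 !mul1r !mul0r !addr0.
      have {}x0 : 0 < x by rewrite lt0r xn0.
      rewrite powR0; last by rewrite gt_eqF//; lra.
      by rewrite addr_ge0// mulr_ge0 ?powR_ge0.
    have -> : t `^ (s + x - 1) = t `^ (s - 1) * t `^ x.
      by rewrite -powRD; [congr (_ `^ _); ring | rewrite (gt_eqF t0) implybT].
    have -> : t `^ (1 + (s - 1)) = t `^ (s - 1) * t.
      rewrite (powRD (r := 1)); last by rewrite (gt_eqF t0) implybT.
      by rewrite powRr1 ?ltW// mulrC.
    rewrite /c1 /c2.
    have : t `^ x <= s `^ x * (1 - x) + s `^ x * x / s * t.
      have := powR_le_affine (divr_ge0 (ltW t0) (ltW s0)) x01.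
      have si0 : 0 <= s^-1 by rewrite invr_ge0 ltW.
      rewrite (powRM _ (ltW t0) si0) -(ler_pM2l (powR_gt0 x s0)).
      have -> : s `^ x * (t `^ x * s^-1 `^ x) = t `^ x.
        by rewrite mulrCA -powRM// ?ltW// mulfV ?gt_eqF// powR1 mulr1.
      by move=> /le_trans; apply; rewrite le_eqVlt; apply/orP; left; apply/eqP; ring.
    move=> /(ler_wpM2l (powR_ge0 t (s - 1))) /le_trans; apply.
    by rewrite le_eqVlt; apply/orP; left; apply/eqP; ring.
rewrite -!EFinM -EFinD lee_fin GammaS// => /le_trans; apply.
rewrite le_eqVlt; apply/orP; left; apply/eqP; rewrite /c1 /c2; field.
by rewrite gt_eqF.
Qed.

Lemma GammaDn x n : 0 <= x ->
  Gamma (n.+1%:R + x) = \prod_(1 <= j < n.+1) (j%:R + x) * Gamma (1 + x).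
Proof.
move=> x0; elim: n => [|n IH]; first by rewrite big_geq// mul1r.
rewrite big_nat_recr//= mulrAC -IH mulrC -GammaS; last first.
  by rewrite ler_wpDr// ler1n.
by rewrite addrA nat1r.
Qed.

Lemma Gamma_nat n : Gamma (n.+1%:R : R) = n`!%:R.
Proof.
rewrite -[n.+1%:R]addr0 GammaDn// addr0 Gamma1 mulr1 fact_prod natr_prod.
by apply: eq_bigr => i _; rewrite addr0.
Qed.

(** Log-convexity from [1 + x] up to [2] gives [1 = Gamma(2) <= (1 + x)^(1 - x) Gamma(1 + x)], which
    rules out the value [0]. *)
Lemma Gamma_gt0 x : 0 <= x <= 1 -> 0 < Gamma (1 + x).
Proof.
move=> /andP[x0 x1].
have := @Gamma_add_le (1 + x) (1 - x).
rewrite (_ : 1 + x + (1 - x) = 2%:R); last by ring.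
rewrite (Gamma_nat 1) => H.
have {}H : 1%R <= (1 + x) `^ (1 - x) * Gamma (1 + x) by apply: H; lra.
rewrite lt0r Gamma_ge0 andbT; apply/eqP => G0.
by move: H; rewrite G0 mulr0; lra.
Qed.

(** The functional equation turns the expression into [Gamma(n+1+x) / ((n+1)^x n!)] over
    [Gamma(1+x)]. Log-convexity, used from [n+1] to [n+1+x] and from [n+1+x] to [n+2], squeezes the
    first quotient to [1]. *)
Lemma Gamma_gauss x : 0 < x <= 1 ->
  (n.+1%:R `^ (- x) * \prod_(1 <= j < n.+1) (1 + x / j%:R)) @[n --> \oo]
    --> (Gamma (1 + x))^-1.
Proof.
move=> /andP[x0 x1].
have x01 : 0 <= x <= 1 by rewrite ltW.
have G0 := Gamma_gt0 x01.
have E (n : nat) : n.+1%:R `^ (- x) * \prod_(1 <= j < n.+1) (1 + x / j%:R) =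
    (n.+1%:R `^ (- x) / n`!%:R * Gamma (n.+1%:R + x)) * (Gamma (1 + x))^-1.
  rewrite GammaDn ?ltW// !mulrA mulfK ?gt_eqF// -!mulrA; congr (_ * _).
  apply: (mulfI (_ : n`!%:R != 0)); first by rewrite pnatr_eq0 -lt0n fact_gt0.
  rewrite mulVKf ?pnatr_eq0 -?lt0n ?fact_gt0//.
  rewrite fact_prod natr_prod -big_split/=.
  apply: eq_big_nat => i /andP[i0 _]; rewrite mulrDr mulr1 mulrC divfK//.
  by rewrite pnatr_eq0 -lt0n.
suff H : (n.+1%:R `^ (- x) / n`!%:R * Gamma (n.+1%:R + x)) @[n --> \oo] --> (1 : R).
  rewrite (funext E) -[(Gamma (1 + x))^-1 in X in _ --> X]mul1r.
  by apply: cvgM => //; exact: cvg_cst.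
apply: (@squeeze_cvgr _ _ _ _ (fun n : nat => (1 + x / n.+1%:R)^-1) (fun=> 1)); last first.
- exact: cvg_cst.
- rewrite -[X in _ --> X]invr1; apply: cvgV; first by rewrite oner_eq0.
  rewrite -[X in _ --> X]addr0; apply: cvgD; first exact: cvg_cst.
  rewrite -[X in _ --> X](mulr0 x); apply: cvgM; first exact: cvg_cst.
  exact: cvg_harmonic.
near=> n.
have n0 : 0 < n.+1%:R :> R by [].
have f0 : 0 < n`!%:R :> R by rewrite ltr0n fact_gt0.
have p0 : 0 < n.+1%:R `^ x :> R by exact: powR_gt0.
have nx0 : 0 < n.+1%:R + x by rewrite addr_gt0.
apply/andP; split; last first.
  rewrite powRN -invfM mulrC ler_pdivrMr ?mulr_gt0// mul1r.
  rewrite -Gamma_nat; apply: Gamma_add_le => //.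
  by rewrite ler1n.
have := @Gamma_add_le (n.+1%:R + x) (1 - x).
have -> : n.+1%:R + x + (1 - x) = n.+2%:R by rewrite -(natr1 n.+1); ring.
rewrite Gamma_nat factS natrM => H.
have {}H : n.+1%:R * n`!%:R <= (n.+1%:R + x) `^ (1 - x) * Gamma (n.+1%:R + x).
  by apply: H; [rewrite ler_wpDr ?ler1n ?ltW | lra].
set g := Gamma _ in H *.
have q0 : 0 < (n.+1%:R + x) `^ (1 - x) by exact: powR_gt0.
have {}H : n.+1%:R * n`!%:R / (n.+1%:R + x) `^ (1 - x) <= g.
  by rewrite ler_pdivrMr// [leRHS]mulrC.
have c0 : 0 <= n.+1%:R `^ (- x) / n`!%:R :> R by rewrite mulr_ge0 ?powR_ge0// invr_ge0 ltW.
apply: (le_trans _ (ler_wpM2l c0 H)).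
have -> : n.+1%:R `^ (- x) / n`!%:R * (n.+1%:R * n`!%:R / (n.+1%:R + x) `^ (1 - x))
   = (n.+1%:R / (n.+1%:R + x)) `^ (1 - x).
  rewrite powRM ?invr_ge0 ?ltW//.
  rewrite -[in RHS]powR_inv1 ?ltW// -[in RHS]powRrM mulN1r [in RHS]powRN.
  rewrite (powRD (x := n.+1%:R) (r := 1) (s := - x)); last by rewrite pnatr_eq0 implybT.
  by rewrite powRr1//; field; rewrite (gt_eqF q0) (gt_eqF f0).
have -> : (1 + x / n.+1%:R)^-1 = n.+1%:R / (n.+1%:R + x).
  by field; rewrite (addrC 1) natr1 (gt_eqF nx0) pnatr_eq0.
(* A base in []0, 1]] does not decrease when raised to the exponent [1 - x <= 1]. *)
apply: ger1_powR; last by lra.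
by rewrite divr_gt0//= ler_pdivrMr// mul1r lerDl ltW.
Unshelve. all: by end_near. Qed.

End GammaFunction.

(** * Mean square limits *)

Section L2Limit.
Context d (T : measurableType d) (R : realType) (P : {measure set T -> \bar R}).

(** Fatou's lemma; as the convergence holds only almost everywhere, the integral of the lower limit
    is first identified with that of [h']. *)
Lemma fatou_cvg (h : nat -> T -> R) (h' : T -> R) (c : nat -> R) (l : R) :
  (forall n, measurable_fun setT (h n)) -> measurable_fun setT h' ->
  (forall n w, 0 <= h n w) -> (forall w, 0 <= h' w) ->
  {ae P, forall w, h n w @[n --> \oo] --> h' w} ->
  (forall n, \int[P]_w (h n w)%:E = (c n)%:E)%E ->
  c @ \oo --> l ->
  (\int[P]_w (h' w)%:E <= l%:E)%E.
Proof.
move=> mh mh' h0 h'0 hcv hc cl.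
have mhE n : measurable_fun setT (fun w => (h n w)%:E) by exact/measurable_EFinP.
have hE0 n w : setT w -> (0 <= (h n w)%:E)%E by rewrite lee_fin.
have := fatou P measurableT mhE hE0.
have lE (v : nat -> R) (a : R) : v @ \oo --> a -> limn_einf (fun n => (v n)%:E) = a%:E.
  move=> va; have va' : (fun n => (v n)%:E) @ \oo --> a%:E by apply: cvg_EFin => //; exact: nearW.
  by rewrite is_cvg_limn_einfE; [exact: cvg_lim | apply/cvg_ex; eexists; exact: va'].
have -> : (\int[P]_w limn_einf (fun n => (h n w)%:E) = \int[P]_w (h' w)%:E)%E.
  apply: ge0_ae_eq_integral => //.
  - rewrite /limn_einf; apply: measurableT_comp => //.
    apply: measurable_fun_limn_esup => n.
    exact: measurableT_comp.
  - exact/measurable_EFinP.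
  - move=> w _; rewrite limn_einf_lim; apply: lime_ge; first exact: is_cvg_einfs.
    apply: nearW => n; apply: le_ereal_inf_tmp => _ [k _ <-].
    by rewrite lee_fin.
  - by move=> w _; rewrite lee_fin.
  - by apply: filterS hcv => w hw _; exact: lE.
have -> : (fun n => \int[P]_w (h n w)%:E)%E = (fun n => (c n)%:E) by exact/funext.
by rewrite (lE _ _ cl).
Qed.

(** Fatou bounds the integral of [g^2] by [V] and that of [(g - f n)^2] by [dl n], the limit in [m]
    of the squared distances [D m n]. The second bound, with a weighted triangle inequality, gives
    the converse estimate of [V]. *)
Lemma L2_limit (f : nat -> T -> R) (g : T -> R) (u : nat -> R)
    (D : nat -> nat -> R) (dl : nat -> R) (V : R) :
  (forall n, measurable_fun setT (f n)) -> measurable_fun setT g ->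
  {ae P, forall w, f n w @[n --> \oo] --> g w} ->
  (forall n, \int[P]_w (f n w ^+ 2)%:E = (u n)%:E)%E ->
  (forall m n, \int[P]_w ((f (m + n)%N w - f n w) ^+ 2)%:E = (D m n)%:E)%E ->
  u @ \oo --> V -> (forall n, D m n @[m --> \oo] --> dl n) ->
  dl @ \oo --> (0 : R) ->
  (\int[P]_w (g w ^+ 2)%:E = V%:E)%E.
Proof.
move=> mf mg fg hu hD uV Ddl dl0.
have mg2 : measurable_fun setT (fun w => (g w ^+ 2)%:E).
  by apply/measurable_EFinP; exact: measurable_funX.
have mfg n : measurable_fun setT (fun w => ((g w - f n w) ^+ 2)).
  by apply: measurable_funX; exact: measurable_funB.
have leV : (\int[P]_w (g w ^+ 2)%:E <= V%:E)%E.
  apply: (@fatou_cvg (fun n w => f n w ^+ 2) _ u) => //.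
  - by move=> n; exact: measurable_funX.
  - exact: measurable_funX.
  - by move=> n w; rewrite sqr_ge0.
  - by move=> w; rewrite sqr_ge0.
  - by apply: filterS fg => w fgw; exact: (cvg_comp _ _ fgw (@exprn_continuous R 2 _)).
have led n : (\int[P]_w ((g w - f n w) ^+ 2)%:E <= (dl n)%:E)%E.
  apply: (@fatou_cvg (fun m w => (f (m + n)%N w - f n w) ^+ 2) _ (D ^~ n)) => //.
  - by move=> m; apply: measurable_funX; exact: measurable_funB.
  - by move=> m w; rewrite sqr_ge0.
  - by move=> w; rewrite sqr_ge0.
  - apply: filterS fg => w fgw; apply: (@cvg_comp _ _ _ _ (fun x => x ^+ 2) _ _ _ _ (@exprn_continuous R 2 _)).
    apply: cvgB; last exact: cvg_cst.
    by move: fgw; rewrite -(cvg_shiftn n).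
have G0 : (0 <= \int[P]_w (g w ^+ 2)%:E)%E.
  by apply: integral_ge0 => w _; rewrite lee_fin sqr_ge0.
have Gfin : (\int[P]_w (g w ^+ 2)%:E)%E \is a fin_num.
  by rewrite ge0_fin_numE// (le_lt_trans leV)// ltry.
apply/eqP; rewrite eq_le leV/=.
rewrite -(fineK Gfin) lee_fin.
set G := fine _.
have G0' : 0 <= G by exact: fine_ge0.
have key e : 0 < e -> V <= (1 + e) * G.
  move=> e0; have ie0 : 0 < e^-1 by rewrite invr_gt0.
  have un n : u n <= (1 + e) * G + (1 + e^-1) * dl n.
    rewrite -lee_fin -hu EFinD !EFinM.
    apply: (@le_trans _ _ ((1 + e)%:E * (\int[P]_w (g w ^+ 2)%:E) +
      (1 + e^-1)%:E * \int[P]_w ((g w - f n w) ^+ 2)%:E)%E); last first.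
      by rewrite leeD// ?fineK// lee_wpmul2l// lee_fin; lra.
    have m2 : measurable_fun setT (fun w => ((g w - f n w) ^+ 2)%:E) by exact/measurable_EFinP.
    rewrite -!ge0_integralZl_EFin//; [|by move=> w _; rewrite lee_fin sqr_ge0|lra
      |by move=> w _; rewrite lee_fin sqr_ge0|lra].
    rewrite -ge0_integralD//; last 4 first.
    - by move=> w _; rewrite -EFinM lee_fin mulr_ge0 ?sqr_ge0//; lra.
    - exact: emeasurable_funM.
    - by move=> w _; rewrite -EFinM lee_fin mulr_ge0 ?sqr_ge0//; lra.
    - exact: emeasurable_funM.
    apply: ge0_le_integral => //.
    - by move=> w _; rewrite lee_fin sqr_ge0.
    - by apply/measurable_EFinP; exact: measurable_funX.
    - by apply: emeasurable_funD; exact: emeasurable_funM.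
    - move=> w _; rewrite -!EFinM -EFinD lee_fin.
      set x := g w; set y := f n w.
      (* The gap in [y^2 <= (1 + e) x^2 + (1 + 1/e) (x - y)^2] is a multiple of a square. *)
      have -> : (1 + e) * x ^+ 2 + (1 + e^-1) * (x - y) ^+ 2 =
          y ^+ 2 + e^-1 * (e * x + (x - y)) ^+ 2 by field; rewrite gt_eqF.
      by rewrite lerDl mulr_ge0 ?sqr_ge0 ?ltW.
  have : (fun n => (1 + e) * G + (1 + e^-1) * dl n) @ \oo --> (1 + e) * G + (1 + e^-1) * 0.
    apply: cvgD; first exact: cvg_cst.
    by apply: cvgM => //; exact: cvg_cst.
  rewrite mulr0 addr0 => cv.
  rewrite -(cvg_lim _ uV)// -(cvg_lim _ cv)//.
  apply: ler_lim; [by apply/cvg_ex; exists V|by apply/cvg_ex; eexists; exact: cv|].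
  exact: nearW.
apply/ler_addgt0Pr => e e0.
(* The denominator [G + 1] covers the case [G = 0] and still gives [e / (G + 1) * G <= e]. *)
have e1 : 0 < e / (G + 1) by rewrite divr_gt0//; lra.
apply: (le_trans (key _ e1)).
rewrite mulrDl mul1r lerD2l mulrAC ler_pdivrMr; last by lra.
by rewrite ler_pM2l//; lra.
Qed.

End L2Limit.

(** * Moments of the walk *)

Section Steps.
Variables (R : realType) (d : nat).

(** The [2 d] pairs [(m, s)] enumerate the matrices [(-1)^s J_d^m], with the identity at
    [(0, false)]; the same pairs encode the possible first steps through [stepv]. *)
Definition stepA (c : 'I_d * bool) : 'M[R]_d := (-1) ^+ c.2 *: Jmat R d ^+ c.1.

Definition stepv (c : 'I_d * bool) : 'cV[R]_d := (-1) ^+ c.2 *: evec R c.1.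

Definition stepw (p : R) (c : 'I_d * bool) : R :=
  if ((c.1 : nat) == 0) && ~~ c.2 then p else (1 - p) / (2 * d - 1)%:R.

Lemma Jmat_exp m (i j : 'I_d) :
  (Jmat R d ^+ m) i j = ((j : nat) == ((i + m) %% d)%N)%:R.
Proof.
elim: m i j => [|m IH] i j.
  by rewrite expr0 addn0 modn_small// mxE eq_sym.
have d0 : (0 < d)%N by exact: leq_ltn_trans (ltn_ord i).
rewrite exprS mxE (bigD1 (Ordinal (ltn_pmod i.+1 d0)))//= big1 ?addr0; last first.
  by move=> k; rewrite -val_eqE/= => /negbTE ki; rewrite mxE ki mul0r.
by rewrite mxE/= eqxx mul1r IH/= modnDml addSnnS.
Qed.

Lemma stepA_orth c : stepA c *m (stepA c)^T = 1%:M.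
Proof.
rewrite /stepA linearZ/= -scalemxAl -scalemxAr scalerA -expr2 sqrr_sign scale1r.
apply/matrixP => i j; rewrite !mxE.
have d0 : (0 < d)%N by exact: leq_ltn_trans (ltn_ord i).
rewrite (bigD1 (Ordinal (ltn_pmod (i + c.1) d0)))//= big1 ?addr0; last first.
  by move=> k; rewrite -val_eqE/= => /negbTE ki; rewrite Jmat_exp ki mul0r.
rewrite mxE !Jmat_exp/= eqxx mul1r eqn_modDr !modn_small//.
Qed.

Lemma stepA_inj : injective stepA.
Proof.
move=> [m s] [m' s'] /matrixP.
have d0 : (0 < d)%N by exact: leq_ltn_trans (ltn_ord m).
move=> /(_ (Ordinal d0) m); rewrite !mxE !Jmat_exp/= !add0n !modn_small// eqxx mulr1.
rewrite -[_ == _ :> nat]/(m == m').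
have [->|_] := eqVneq m m'; last by move=> /eqP; rewrite mulr0 signr_eq0.
by rewrite mulr1; case: s s' => -[]//=; rewrite expr1 expr0 => H; exfalso; lra.
Qed.

Lemma stepv_inj : injective stepv.
Proof.
move=> [m s] [m' s'] /matrixP /(_ m 0); rewrite !mxE/= eqxx mulr1.
have [->|_] := eqVneq m m'; last by move=> /eqP; rewrite mulr0 signr_eq0.
by rewrite mulr1; case: s s' => -[]//=; rewrite expr1 expr0 => H; exfalso; lra.
Qed.

Lemma stepA_Aother c : stepA c = Aother R d (2 * c.1 + c.2).
Proof.
rewrite /stepA /Aother mulnC modnMDl divnMDl//.
by case: c => m [] /=; rewrite ?addn0.
Qed.

Lemma pmf_A_stepA p c : pmf_A p (stepA c) = stepw p c.
Proof.
have d0 : (0 < d)%N by exact: leq_ltn_trans (ltn_ord c.1).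
have c01 : stepA (Ordinal d0, false) = 1%:M by rewrite /stepA/= expr0 scale1r.
rewrite /pmf_A /stepw -c01 (inj_eq stepA_inj).
have -> : (c == (Ordinal d0, false)) = (c.1 == 0 :> nat) && ~~ c.2.
  by case: c => m [] /=; rewrite xpair_eqE ?andbF ?andbT.
case: ifPn => // cn0; rewrite ifT//; apply/existsP.
have lt : (2 * c.1 + c.2 < 2 * d)%N.
  have := ltn_ord c.1; case: (c.2) => /=; lia.
exists (Ordinal lt) => /=; rewrite -stepA_Aother eqxx andbT.
by move: cn0; case: (c.2); rewrite ?andbF//=; lia.
Qed.

Lemma pmf_X1_stepv c : pmf_X1 (stepv c) = (2 * d)%:R^-1.
Proof.
rewrite /pmf_X1 ifT//; apply/existsP; exists c.1; rewrite /stepv.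
by case: (c.2); rewrite ?expr1 ?expr0 ?scale1r ?scaleN1r eqxx ?orbT.
Qed.

Lemma sum_code (V : zmodType) (F : 'I_d * bool -> V) :
  \sum_c F c = \sum_(m < d) (F (m, true) + F (m, false)).
Proof.
transitivity (\sum_(m < d) \sum_(s : bool) F (m, s)).
  by rewrite pair_big/=; apply: eq_bigr => -[].
by apply: eq_bigr => m _; rewrite big_bool.
Qed.

(** Expressed in [x = d.-1 >= 0], the denominator [2 x + 1] is visibly positive for [field] and
    [lra]. *)
Lemma pred_double_natr : (0 < d)%N -> (2 * d - 1)%:R = 2 * d.-1%:R + 1 :> R.
Proof. by move=> d0; rewrite -natrM natr1; congr (_%:R); lia. Qed.

Lemma sum_stepw p : (0 < d)%N -> \sum_c stepw p c = 1.
Proof.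
move=> d0; rewrite sum_code (bigD1 (Ordinal d0))//= /stepw/=.
under eq_bigr => i /negbTE i0.
  rewrite -[(i : nat) == 0]/(i == Ordinal d0) i0 /=.
  over.
rewrite sumr_const cardC1 card_ord -[_ *+ d.-1]mulr_natr (pred_double_natr d0).
have := ler0n R d.-1; move: (d.-1%:R) => x x0.
by field; lra.
Qed.

(** The parameter [a] of the theorem: the scalar for which [E[A_n] = a I_d]. *)
Definition drift (p : R) : R := ((2 * d)%:R * p - 1) / (2 * d - 1)%:R.

(** For [m > 0] the matrices [J_d^m] and [- J_d^m] have equal weight and cancel; what remains is
    [p - (1 - p) / (2 d - 1) = a] times the identity. *)
Lemma sum_stepA p : (0 < d)%N -> \sum_c stepw p c *: stepA c = (drift p)%:M.
Proof.
move=> d0; rewrite sum_code (bigD1 (Ordinal d0))//= big1 ?addr0; last first.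
  move=> i; rewrite -val_eqE/= => /negbTE i0.
  by rewrite /stepw /stepA/= i0/= expr1 expr0 scale1r scaleN1r scalerN addNr.
rewrite /stepw /stepA/= !expr0 expr1 scale1r scaleN1r scalerN -scaleNr -scalerDl.
rewrite -[RHS]scalemx1 /drift (pred_double_natr d0); congr (_ *: _).
have -> : (2 * d)%:R = 2 * d.-1%:R + 2 :> R by rewrite -natrM -natrD; congr (_%:R); lia.
have := ler0n R d.-1; move: (d.-1%:R) => x x0.
by field; lra.
Qed.

End Steps.

(** * Moments over the finite set of histories *)

Section Moments.
Variables (R : realType) (d : nat) (p : R).
Local Notation a := (drift d p).
Local Notation stepA := (@stepA R d).
Local Notation stepv := (@stepv R d).
Local Notation stepw := (@stepw R d p).

(* [hist N] encodes the possible values of [X_1, (b_1, A_1), ..., (b_N, A_N)];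
   an index [j : 'I_N.+1] stands for [b_(N+1) = j + 1]. *)
Fixpoint hist (N : nat) : finType :=
  if N is N'.+1 then (hist N' * ('I_N'.+1 * ('I_d * bool)))%type
  else ('I_d * bool)%type.

Fixpoint hprob N : hist N -> R :=
  match N with
  | 0 => fun=> (2 * d)%:R^-1
  | N'.+1 => fun h => hprob h.1 * (N'.+1%:R^-1 * stepw h.2.2)
  end.

(** Meaningful at the indices [1] to [N.+1]; any other index falls through to the first step. *)
Fixpoint hX N : hist N -> nat -> 'cV[R]_d :=
  match N with
  | 0 => fun c _ => stepv c
  | N'.+1 => fun h i =>
      if i == N'.+2 then stepA h.2.2 *m hX h.1 h.2.1.+1 else hX h.1 i
  end.

Definition hS N (h : hist N) n := \sum_(1 <= i < n.+1) hX h i.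

(** Expectation under [hprob], with values in any module so that vectors and matrices share the same
    rules. *)
Definition hE N (V : lmodType R) (F : hist N -> V) := \sum_h hprob h *: F h.

Lemma hE_linear N (V W : lmodType R) (f : {linear V -> W}) (F : hist N -> V) :
  hE (fun h => f (F h)) = f (hE F).
Proof. by rewrite /hE linear_sum; apply: eq_bigr => h _; rewrite linearZ. Qed.

Lemma hED N (V : lmodType R) (F G : hist N -> V) :
  hE (fun h => F h + G h) = hE F + hE G.
Proof. by rewrite /hE -big_split/=; apply: eq_bigr => h _; rewrite scalerDr. Qed.

Lemma hEZ N (V : lmodType R) (k : R) (F : hist N -> V) :
  hE (fun h => k *: F h) = k *: hE F.
Proof. by rewrite /hE scaler_sumr; apply: eq_bigr => h _; rewrite !scalerA mulrC. Qed.

Lemma hE_sum N (V : lmodType R) (I : Type) (r : seq I) (F : I -> hist N -> V) :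
  hE (fun h => \sum_(i <- r) F i h) = \sum_(i <- r) hE (F i).
Proof. by rewrite /hE exchange_big/=; apply: eq_bigr => h _; rewrite scaler_sumr. Qed.

Lemma eq_hE N (V : lmodType R) (F G : hist N -> V) : F =1 G -> hE F = hE G.
Proof. by move=> FG; apply: eq_bigr => h _; rewrite FG. Qed.

(** Tower property: the last pair is averaged first, with the earlier history fixed. *)
Lemma hES N (V : lmodType R) (F : hist N.+1 -> V) :
  hE F = hE (fun h : hist N => N.+1%:R^-1 *:
    \sum_(j < N.+1) \sum_c stepw c *: F (h, (j, c))).
Proof.
rewrite /hE/=.
transitivity (\sum_(h : hist N) \sum_(jc : 'I_N.+1 * ('I_d * bool))
    (hprob h * (N.+1%:R^-1 * stepw jc.2)) *: F (h, jc)).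
  by rewrite pair_big/=; apply: eq_bigr => -[].
apply: eq_bigr => h _.
rewrite scalerA scaler_sumr.
under [RHS]eq_bigr do rewrite scaler_sumr.
by rewrite pair_big/=; apply: eq_bigr => -[j c] _ /=; rewrite scalerA mulrA.
Qed.

Lemma hX_prefix N (h : hist N.+1) i : (i <= N.+1)%N -> hX h i = hX h.1 i.
Proof. by move=> iN /=; rewrite ifF//; lia. Qed.

Lemma hS_prefix N (h : hist N.+1) n : (n <= N.+1)%N -> hS h n = hS h.1 n.
Proof. by move=> nN; apply: eq_big_nat => i iN; rewrite hX_prefix//; lia. Qed.

Lemma hSS N (h : hist N.+1) :
  hS h N.+2 = hS h.1 N.+1 + stepA h.2.2 *m hX h.1 h.2.1.+1.
Proof. by rewrite /hS big_nat_recr//= -/(hS h N.+1) (hS_prefix h (leqnn _)) eqxx. Qed.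

Hypothesis d_gt0 : (0 < d)%N.

Lemma hE_prefix N (V : lmodType R) (F : hist N -> V) :
  hE (fun h : hist N.+1 => F h.1) = hE F.
Proof.
rewrite hES; apply: eq_hE => h /=.
under eq_bigr do rewrite -scaler_suml sum_stepw// scale1r.
by rewrite sumr_const card_ord -[F h *+ _]scaler_nat scalerA mulVf ?scale1r// pnatr_eq0.
Qed.

Lemma hE_const N (V : lmodType R) (v : V) : hE (fun _ : hist N => v) = v.
Proof.
elim: N => [|N IH]; last by rewrite (hE_prefix (fun=> v)).
rewrite /hE/= sumr_const -scaler_nat scalerA card_prod card_ord card_bool mulnC.
by rewrite mulfV ?scale1r// pnatr_eq0; lia.
Qed.

Lemma next_mean N (h : hist N) :
  N.+1%:R^-1 *: \sum_(j < N.+1) \sum_c stepw c *: (stepA c *m hX h j.+1)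
  = (a / N.+1%:R) *: hS h N.+1.
Proof.
have E (j : 'I_N.+1) : \sum_c stepw c *: (stepA c *m hX h j.+1) = a *: hX h j.+1.
  under eq_bigr do rewrite scalemxAl.
  by rewrite -mulmx_suml sum_stepA// mul_scalar_mx.
rewrite (eq_bigr _ (fun j _ => E j)) -scaler_sumr scalerA mulrC; congr (_ *: _).
by rewrite /hS big_add1/= big_mkord.
Qed.

(** Since [f] may depend on the earlier history, factors known at that time, such as a transposed
    earlier position, can be pulled out of the conditional expectation. *)
Lemma mean_linear N (V : lmodType R) (f : hist N -> {linear 'cV[R]_d -> V}) :
  hE (fun h : hist N.+1 => f h.1 (stepA h.2.2 *m hX h.1 h.2.1.+1)) =
  (a / N.+1%:R) *: hE (fun h : hist N => f h (hS h N.+1)).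
Proof.
rewrite hES -hEZ; apply: eq_hE => h /=.
rewrite -linearZ_LR -next_mean linearZ_LR; congr (_ *: _); rewrite linear_sum.
by apply: eq_bigr => j _; rewrite linear_sum; apply: eq_bigr => c _; rewrite linearZ_LR.
Qed.

Lemma mean_S N : hE (fun h : hist N => hS h N.+1) = 0.
Proof.
elim: N => [|N IH].
  rewrite /hE (eq_bigr (fun c : 'I_d * bool => (2 * d)%:R^-1 *: stepv c)); last first.
    by move=> c _; rewrite /hS big_nat1.
  rewrite -scaler_sumr sum_code big1 ?scaler0// => i _.
  by rewrite /stepv/= expr1 expr0 scale1r scaleN1r addNr.
rewrite (eq_hE (hSS (N := N))) hED (hE_prefix (fun h => hS h N.+1)) IH add0r.
by rewrite (mean_linear (fun=> (idfun : {linear 'cV[R]_d -> 'cV[R]_d}))) IH scaler0.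
Qed.

(** The uniform first step has second moment [I / d], and conjugation by the orthogonal matrices
    [stepA c] preserves multiples of the identity; so every remembered step gives the same value. *)
Lemma second_moment_X N i : (i <= N)%N ->
  hE (fun h : hist N => hX h i.+1 *m (hX h i.+1)^T) = (d%:R^-1)%:M.
Proof.
have d0 : d%:R != 0 :> R by rewrite pnatr_eq0; lia.
elim: N i => [|N IH] i iN.
  rewrite /hE/= -scaler_sumr sum_code.
  rewrite (eq_bigr (fun m => 2 *: (evec R m *m (evec R m)^T))); last first.
    move=> m _; rewrite /stepv/= expr1 expr0 scale1r scaleN1r linearN/= mulNmx mulmxN opprK.
    by rewrite -[in RHS](mulr_natl 1) mulr1 scaler_nat mulr2n.
  rewrite -scaler_sumr scalerA natrM invfM mulrAC mulVf ?mul1r// ?pnatr_eq0//.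
  apply/matrixP => k l; rewrite !mxE summxE.
  rewrite (bigD1 k)//= big1 ?addr0; last first.
    by move=> m /negbTE mk; rewrite !mxE big_ord1 !mxE eq_sym mk mul0r.
  by rewrite !mxE big_ord1 !mxE eqxx mul1r eq_sym mulr_natr.
move: iN; rewrite leq_eqVlt => /predU1P[->|iN]; last first.
  rewrite (eq_hE (G := fun h : hist N.+1 => hX h.1 i.+1 *m (hX h.1 i.+1)^T)); last first.
    by move=> h; rewrite hX_prefix.
  by rewrite (hE_prefix (fun h => hX h i.+1 *m (hX h i.+1)^T)) IH.
rewrite hES/= eqxx.
rewrite hEZ hE_sum.
have E (j : 'I_N.+1) : hE (fun h : hist N => \sum_c stepw c *:
     (stepA c *m hX h j.+1 *m (stepA c *m hX h j.+1)^T)) = (d%:R^-1)%:M.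
  transitivity (\sum_c stepw c *: (d%:R^-1)%:M : 'M[R]_d); last first.
    by rewrite -scaler_suml sum_stepw// scale1r.
  rewrite hE_sum.
  apply: eq_bigr => c _; rewrite hEZ; congr (_ *: _).
  (* Written as left and right multiplications, the conjugation is a composition of linear maps and
     commutes with [hE]. *)
  rewrite (eq_hE (G := fun h => mulmx (stepA c) (mulmxr (stepA c)^T (hX h j.+1 *m (hX h j.+1)^T)))).
    rewrite !hE_linear/= IH; last by rewrite -ltnS ltn_ord.
    by rewrite mul_scalar_mx -scalemxAr stepA_orth scalemx1.
  by move=> h /=; rewrite trmx_mul !mulmxA.
rewrite (eq_bigr _ (fun j _ => E j)) sumr_const card_ord -[_%:M *+ _]scaler_nat scalerA.
by rewrite mulVf ?scale1r// pnatr_eq0.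
Qed.

(** [varS N] is [v_(N+1)], the value of [E[|S_(N+1)|^2]]. *)
Fixpoint varS N : R :=
  if N is N'.+1 then (1 + 2 * a / N'.+1%:R) * varS N' + 1 else 1.

(** When the new step is added, each of the two mutually transposed cross terms contributes
    [a / N.+1] times the previous moment, and the square of the step contributes [I / d]. *)
Lemma second_moment_S N :
  hE (fun h : hist N => hS h N.+1 *m (hS h N.+1)^T) = (varS N / d%:R)%:M.
Proof.
elim: N => [|N IH].
  rewrite (eq_hE (G := fun h : hist 0 => hX h 1 *m (hX h 1)^T)).
    by rewrite second_moment_X// mul1r.
  by move=> h; rewrite /hS big_nat1.
pose x (h : hist N.+1) := stepA h.2.2 *m hX h.1 h.2.1.+1.
rewrite (eq_hE (G := fun h : hist N.+1 =>
   hS h.1 N.+1 *m (hS h.1 N.+1)^T + (mulmxr (hS h.1 N.+1)^T (x h) +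
   (mulmxr (hS h.1 N.+1)^T (x h))^T) + hX h N.+2 *m (hX h N.+2)^T)); last first.
  move=> h; rewrite hSS -/(x h) /= eqxx -/(x h) trmx_mul trmxK.
  by rewrite linearD/= mulmxDl !mulmxDr !addrA; congr (_ + _); rewrite addrAC.
rewrite !hED second_moment_X// (hE_prefix (fun h => hS h N.+1 *m (hS h N.+1)^T)) IH.
rewrite (hE_linear trmx) (mean_linear (fun h => mulmxr (hS h N.+1)^T)) IH.
rewrite linearZ/= tr_scalar_mx -scalerDl scale_scalar_mx -!(raddfD (@scalar_mx R d))/=; congr (_%:M).
by field; rewrite nat1r !pnatr_eq0 -lt0n d_gt0.
Qed.

(** [growth n] is [alpha_(n+1)], the factor by which [S_(n+1)] must be divided to become a
    martingale. *)
Definition growth n : R := \prod_(1 <= j < n.+1) (1 + a / j%:R).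

(** Induction on [N] from [n] on: the earlier position is a known factor, so each further step
    multiplies the moment by [1 + a / N.+1]. *)
Lemma cross_moment_S N n : (n <= N)%N -> (forall i, growth i != 0) ->
  hE (fun h : hist N => hS h N.+1 *m (hS h n.+1)^T)
  = (growth N / growth n * (varS n / d%:R))%:M.
Proof.
move=> nN g0; elim: N nN => [|N IH].
  by rewrite leqn0 => /eqP ->; rewrite second_moment_S mulfV ?g0// [in RHS]mul1r.
rewrite leq_eqVlt => /predU1P[->|nN].
  by rewrite second_moment_S mulfV ?g0// [in RHS]mul1r.
rewrite (eq_hE (G := fun h : hist N.+1 => hS h.1 N.+1 *m (hS h.1 n.+1)^T +
   mulmxr (hS h.1 n.+1)^T (stepA h.2.2 *m hX h.1 h.2.1.+1))); last first.
  by move=> h; rewrite hSS hS_prefix//= mulmxDl.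
rewrite hED (hE_prefix (fun h => hS h N.+1 *m (hS h n.+1)^T)) IH//.
rewrite (mean_linear (fun h => mulmxr (hS h n.+1)^T)) IH//.
rewrite scale_scalar_mx -raddfD/=; congr (_%:M).
rewrite [growth N.+1]/growth big_nat_recr//= -/(growth N).
by field; rewrite nat1r !pnatr_eq0 -lt0n d_gt0 g0.
Qed.

End Moments.

(** * Transfer from finite histories to the probability space *)

Section Coupling.
Context (R : realType) (d0 : measure_display) (T : measurableType d0).
Variables (P : probability T R) (d : nat) (p : R).
Variables (X : nat -> T -> 'cV[R]_d) (b : nat -> T -> nat) (A : nat -> T -> 'M[R]_d).
Hypothesis merw : is_MERW P p X b A.

Fixpoint hev N : hist d N -> set T :=
  match N with
  | 0 => fun c => [set w | X 1%N w = stepv R c]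
  | N'.+1 => fun h => hev h.1 `&`
      [set w | b N'.+1 w = h.2.1.+1 /\ A N'.+1 w = stepA R h.2.2]
  end.

Lemma hev_measurable N (h : hist d N) : measurable (hev h).
Proof.
have [mX mb mA _ _] := merw.
elim: N h => [|N IH] h /=; first exact: mX.
by apply: measurableI => //; apply: measurableI; [exact: mb | exact: mA].
Qed.

Lemma hev_inj N (h h' : hist d N) w : hev h w -> hev h' w -> h = h'.
Proof.
elim: N h h' => [|N IH] /=.
  by move=> c c' -> /stepv_inj.
move=> [h [j c]] [h' [j' c']] /= [hw [bw Aw]] [hw' [bw' Aw']].
rewrite (IH _ _ hw hw'); congr (_, (_, _)).
  by apply/val_inj; move: bw'; rewrite bw => -[].
by apply: (@stepA_inj R); rewrite -Aw -Aw'.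
Qed.

(** The law in [is_MERW] is indexed by functions on [nat], so [h] is turned into such functions [k]
    and [M]; each induction step alters them at the single index [N.+1]. *)
Lemma hev_prob N (h : hist d N) : P (hev h) = (hprob p h)%:E.
Proof.
have [_ _ _ law _] := merw.
suff [x [k [M [-> ->]]]] : exists x k M,
    hev h = [set w | X 1%N w = x /\
      (forall i, (1 <= i <= N)%N -> b i w = k i /\ A i w = M i)] /\
    hprob p h = pmf_X1 x * \prod_(1 <= i < N.+1) (pmf_b R i (k i) * pmf_A p (M i)).
  exact: law.
elim: N h => [|N IH] h.
  exists (stepv R h), (fun=> 0%N), (fun=> 0); split.
    by apply/seteqP; split => w /= => [->|[]//]; split => // i; lia.
  by rewrite big_geq// mulr1 pmf_X1_stepv.
have [x [k [M [Eh Ep]]]] := IH h.1.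
exists x, (fun i => if i == N.+1 then h.2.1.+1 else k i),
  (fun i => if i == N.+1 then stepA R h.2.2 else M i); split.
  rewrite /= Eh; apply/seteqP; split => w /=.
    move=> [[-> H] Hw]; split => // i iN.
    by case: eqVneq => [->//|iN1]; apply: H; lia.
  move=> [-> H]; split; last by have := H N.+1; rewrite eqxx; apply; lia.
  by split => // i iN; have := H i; case: eqVneq => [?|_]; [lia | apply; lia].
rewrite big_nat_recr//= eqxx Ep -!mulrA; congr (_ * (_ * _)).
  by apply: eq_big_nat => i iN; have -> : (i == N.+1) = false by lia.
by rewrite pmf_A_stepA /pmf_b ltn_ord.
Qed.

Lemma hev_X N (h : hist d N) w i : hev h w -> (i <= N)%N -> X i.+1 w = hX R h i.+1.
Proof.
have [_ _ _ _ rec] := merw.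
elim: N h i => [|N IH] h i /=; first by move=> hw; rewrite leqn0 => /eqP ->.
move=> [hw [bw Aw]]; rewrite leq_eqVlt => /predU1P[->|iN]; last first.
  have -> : (i.+1 == N.+2) = false by apply/eqP; lia.
  exact: IH.
have jN := ltn_ord h.2.1.
by rewrite eqxx rec bw// Aw (IH h.1).
Qed.

Lemma hev_S N (h : hist d N) w n : hev h w -> (n <= N.+1)%N -> Spos X n w = hS R h n.
Proof.
move=> hw nN; apply: eq_big_nat => -[|i]// iN; apply: hev_X => //; lia.
Qed.

Lemma hev_prefix N (h : hist d N) w n : hev h w -> (n <= N)%N -> exists h' : hist d n, hev h' w.
Proof.
elim: N h => [|N IH] h hw; first by rewrite leqn0 => /eqP ->; exists h.
rewrite leq_eqVlt => /predU1P[->|nN]; first by exists h.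
by case: hw => hw _; exact: IH hw _.
Qed.

(* [X n] is arbitrary, hence possibly not measurable, on the null event where some
   [b i] leaves its range; [hsim] provides measurable versions. *)
Definition hsim N (phi : hist d N -> R) (w : T) : R := \sum_h phi h * \1_(hev h) w.

Lemma hsimE N (phi : hist d N -> R) h w : hev h w -> hsim phi w = phi h.
Proof.
move=> hw; rewrite /hsim (bigD1 h)//= indicE mem_set// mulr1 big1 ?addr0// => h' hh'.
rewrite indicE memNset ?mulr0// => hw'.
by move/eqP: hh'; apply; exact: hev_inj hw' hw.
Qed.

Lemma hsim_measurable N (phi : hist d N -> R) : measurable_fun setT (hsim phi).
Proof.
apply: measurable_sum => h; apply: measurable_funM => //.
exact: measurable_indic (hev_measurable h).
Qed.

Lemma integrable_hsim_term N (phi : hist d N -> R) (h : hist d N) :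
  P.-integrable setT (fun w => (phi h * \1_(hev h) w)%:E).
Proof.
under eq_fun do rewrite EFinM.
apply: integrableZl => //; apply: integrable_indic => //.
exact: hev_measurable.
Qed.

Lemma integral_hsim N (phi : hist d N -> R) :
  (\int[P]_w (hsim phi w)%:E = (\sum_h hprob p h * phi h)%:E)%E.
Proof.
rewrite /hsim; under eq_integral do rewrite -sumEFin.
rewrite integral_sum//; last by move=> h; exact: integrable_hsim_term.
rewrite -sumEFin; apply: eq_bigr => h _.
under eq_integral do rewrite EFinM.
rewrite integralZl//.
  rewrite integral_indic//; last exact: hev_measurable.
  rewrite setIT [X in (_ * X)%E](_ : _ = (hprob p h)%:E); last exact: hev_prob.
  by rewrite -EFinM mulrC.
by apply: integrable_indic => //; exact: hev_measurable.
Qed.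

Hypothesis d_gt0 : (0 < d)%N.

(** The weights [hprob] add up to [1], so the disjoint history events exhaust the space up to a null
    set. *)
Lemma ae_hev N : {ae P, forall w, exists h : hist d N, hev h w}.
Proof.
pose G := [set w | exists h : hist d N, hev h w].
have GE : G = (hsim (fun _ : hist d N => 1)) @^-1` [set 1].
  apply/seteqP; split => w /= => [[h hw]|]; first exact: hsimE hw.
  move=> H; apply: contrapT => nG; move: H; rewrite /hsim big1 => [/eqP|h _].
    by rewrite eq_sym oner_eq0.
  by rewrite indicE memNset ?mulr0// => hw; apply: nG; exists h.
have mG : measurable G.
  by rewrite GE -[X in measurable X]setTI; exact: hsim_measurable.
have PG : P G = 1%E.
  have -> : P G = (\int[P]_w (\1_G w)%:E)%E by rewrite integral_indic// setIT.
  have -> : 1%E = (\int[P]_w (hsim (fun _ : hist d N => 1) w)%:E)%E.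
    rewrite integral_hsim; congr EFin.
    exact: esym (@hE_const R d p d_gt0 N R^o 1).
  apply: eq_integral => w _; congr EFin; rewrite indicE.
  case: (pselect (G w)) => [[h hw]|nG].
    by rewrite mem_set; [rewrite (hsimE _ hw) | exists h].
  rewrite memNset// /hsim big1// => h _.
  by rewrite indicE memNset ?mulr0// => hw; apply: nG; exists h.
exists (~` G); split => //; first exact: measurableC.
by rewrite probability_setC// PG subee.
Qed.

(** Such an [f] agrees almost everywhere with the simple function [hsim]; this reduces expectations
    to finite sums over histories. *)
Lemma integral_hist N (f : T -> R) (phi : hist d N -> R) :
  measurable_fun setT f -> (forall h w, hev h w -> f w = phi h) ->
  (\int[P]_w (f w)%:E = (\sum_h hprob p h * phi h)%:E)%E.
Proof.
move=> mf fE; rewrite -integral_hsim; apply: ae_eq_integral => //.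
- exact/measurable_EFinP.
- by apply/measurable_EFinP; exact: hsim_measurable.
- by apply: filterS (ae_hev N) => w [h hw] _; rewrite (fE _ _ hw) (hsimE _ hw).
Qed.

End Coupling.

(** * Moments of the limit *)

Section Asymptotics.
Variables (R : realType) (d : nat) (p : R).
Hypothesis d_gt0 : (0 < d)%N.
Local Notation a := (drift d p).
Hypothesis a_bounds : 2^-1 < a <= 1.

Lemma growth_neq0 n : growth d p n != 0.
Proof.
have /andP[a0 _] := a_bounds.
rewrite /growth; elim/big_ind: _ => //; first by move=> x y; exact: mulf_neq0.
by move=> i _; rewrite gt_eqF// ltr_pwDl// divr_ge0//; lra.
Qed.

(** The recursion for [v_m], where [m = n.+1], has the particular solution [- m / (2 a - 1)] and the
    homogeneous solution [m prod_(j <= m) (1 + (2 a - 1) / j)]; the value [v_1 = 1] fixes the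
    combination. *)
Lemma varS_closed n : varS d p n =
  n.+1%:R * (\prod_(1 <= j < n.+2) (1 + (2 * a - 1) / j%:R) - 1) / (2 * a - 1).
Proof.
have /andP[a0 _] := a_bounds; have y0 : 2 * a - 1 != 0 by rewrite gt_eqF//; lra.
elim: n => [|n IH]; first by rewrite big_nat1 /=; field.
rewrite big_nat_recr//= IH.
have n1 : n%:R + 1 != 0 :> R by rewrite natr1 pnatr_eq0.
have n2 : n%:R + 1 + 1 != 0 :> R by rewrite !natr1 pnatr_eq0.
rewrite -!natr1; move: (\prod_(_ <= _ < _) _) (n%:R : R) n1 n2 => q x n1 n2.
by field; rewrite y0 n1 n2.
Qed.

Lemma cvg_powRN (y : R) : 0 < y -> (n.+1%:R `^ (- y) : R) @[n --> \oo] --> (0 : R).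
Proof.
move=> y0; have [H _] := cvg_at_rightP (fun x : R => x `^ y) 0 0.
have := H (powR_cvg0 y0) (fun n => n.+1%:R^-1).
have -> : (fun n => n.+1%:R `^ (- y)) = (fun n => (n.+1%:R^-1) `^ y) :> (nat -> R).
  by apply/funext => n; rewrite -powR_inv1// -powRrM mulN1r.
by apply; split => [n|]; [rewrite invr_gt0 | exact: cvg_harmonic].
Qed.

Lemma cvg_growth :
  (n.+1%:R `^ (- a) * growth d p n) @[n --> \oo] --> (Gamma (1 + a))^-1.
Proof. by have /andP[? ?] := a_bounds; apply: Gamma_gauss; lra. Qed.

(** With [y = 2 a - 1] the squared weight is [(n+1)^(-y) / (n+1)]. The factor [n+1] of the closed
    form cancels, Gauss' product at [y] gives [1 / Gamma(1 + y)], and the separate term [(n+1)^(-y)]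
    vanishes because [y > 0]. *)
Lemma cvg_varS : ((n.+1%:R `^ (- a)) ^+ 2 * varS d p n) @[n --> \oo]
  --> ((2 * a - 1) * Gamma (2 * a))^-1.
Proof.
have /andP[a0 a1] := a_bounds; set y := 2 * a - 1.
have y01 : 0 < y <= 1 by rewrite /y; lra.
have [y0 _] := andP y01.
have yn0 : y != 0 by rewrite gt_eqF.
pose q n : R := \prod_(1 <= j < n.+1) (1 + y / j%:R).
have E n : (n.+1%:R `^ (- a)) ^+ 2 * varS d p n =
   (n.+1%:R `^ (- y) * q n * (1 + y / n.+1%:R) - n.+1%:R `^ (- y)) * y^-1.
  rewrite varS_closed -/y big_nat_recr//= -/(q n).
  have -> : (n.+1%:R `^ (- a)) ^+ 2 = n.+1%:R `^ (- y) / n.+1%:R.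
    rewrite expr2 -powRD; last by rewrite pnatr_eq0 implybT.
    rewrite -[X in _ / X]powRr1// -powRB; last by rewrite pnatr_eq0 implybT.
    by congr (_ `^ _); rewrite /y; ring.
  by field; rewrite yn0 nat1r pnatr_eq0.
rewrite (funext E) (_ : 2 * a = 1 + y); last by rewrite /y; ring.
have -> : (y * Gamma (1 + y))^-1 = ((Gamma (1 + y))^-1 * (1 + y * 0) - 0) * y^-1.
  by rewrite mulr0 addr0 subr0 mulr1 invfM mulrC.
apply: cvgM; last exact: cvg_cst.
apply: cvgB; last exact: cvg_powRN.
apply: cvgM; first exact: Gamma_gauss.
apply: cvgD; first exact: cvg_cst.
by apply: cvgM; [exact: cvg_cst | exact: cvg_harmonic].
Qed.

Lemma second_moment_S_le N n : (n <= N)%N ->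
  hE p (fun h : hist d N => hS R h n.+1 *m (hS R h n.+1)^T) = (varS d p n / d%:R)%:M.
Proof.
elim: N => [|N IH]; first by rewrite leqn0 => /eqP ->; exact: second_moment_S.
rewrite leq_eqVlt => /predU1P[->|nN]; first exact: second_moment_S.
rewrite -IH// -[RHS](hE_prefix p d_gt0); apply: eq_hE => h.
by rewrite hS_prefix.
Qed.

(** With normalizing weights this measures the distance between two rescaled positions; [s' = 0]
    recovers the second moment of a single one. *)
Lemma second_moment_diff N n (s s' : R) : (n <= N)%N ->
  hE p (fun h : hist d N => (s *: hS R h N.+1 - s' *: hS R h n.+1) *m
                          (s *: hS R h N.+1 - s' *: hS R h n.+1)^T) =
  ((s ^+ 2 * varS d p N + s' ^+ 2 * varS d p n
    - 2 * (s * s') * (growth d p N / growth d p n * varS d p n)) / d%:R)%:M.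
Proof.
move=> nN.
pose M (h : hist d N) := hS R h N.+1 *m (hS R h n.+1)^T.
rewrite (eq_hE _ (G := fun h : hist d N =>
    s ^+ 2 *: (hS R h N.+1 *m (hS R h N.+1)^T) + s' ^+ 2 *: (hS R h n.+1 *m (hS R h n.+1)^T)
    + (- (s * s')) *: (M h + (M h)^T))); last first.
  move=> h; rewrite /M; move: (hS R h N.+1) (hS R h n.+1) => U V.
  have -> : (s *: U - s' *: V)^T = s *: U^T - s' *: V^T by rewrite linearB/= !linearZ.
  rewrite mulmxBl !mulmxBr trmx_mul trmxK.
  rewrite -!scalemxAl -!scalemxAr.
  move: (U *m U^T) (U *m V^T) (V *m U^T) (V *m V^T) => UU UV VU VV.
  by apply/matrixP => i j; rewrite !mxE; ring.
have HM : hE p M = _ := cross_moment_S d_gt0 nN growth_neq0.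
rewrite !hED !hEZ hED (hE_linear _ trmx) HM /=.
rewrite !second_moment_S_le// tr_scalar_mx -(raddfD (@scalar_mx R d)) !scale_scalar_mx.
rewrite -!(raddfD (@scalar_mx R d)); congr (_%:M) => /=.
by field; rewrite growth_neq0 pnatr_eq0 -lt0n d_gt0.
Qed.

(** Both sides are [c^T E[Z Z^T] c]. *)
Lemma hE_quad N (c : 'cV[R]_d) (Z : hist d N -> 'cV[R]_d) (k : R) :
  hE p (fun h => Z h *m (Z h)^T) = k%:M ->
  \sum_h hprob p h * (\sum_i c i 0 * Z h i 0) ^+ 2 = k * \sum_i c i 0 ^+ 2.
Proof.
move=> Hk.
have linE (v : 'cV[R]_d) : \sum_i c i 0 * v i 0 = (c^T *m v) 0 0.
  by rewrite mxE; apply: eq_bigr => i _; rewrite mxE.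
transitivity ((c^T *m k%:M *m c) 0 0); last first.
  rewrite mul_mx_scalar -scalemxAl mxE mxE; congr (_ * _).
  by apply: eq_bigr => i _; rewrite mxE expr2.
rewrite -Hk /hE mulmx_sumr mulmx_suml summxE; apply: eq_bigr => h _.
rewrite -scalemxAr -scalemxAl [RHS]mxE; congr (_ * _).
have -> : c^T *m (Z h *m (Z h)^T) *m c = (c^T *m Z h) *m (c^T *m Z h)^T.
  by rewrite trmx_mul trmxK !mulmxA.
by rewrite linE [RHS]mxE big_ord1 [X in _ = _ * X]mxE expr2.
Qed.

(** The vanishing mean kills the cross term. The constant [t] is carried along so that polarization
    against [1] can later recover the mean of the limit. *)
Lemma hE_affine_sq N (c : 'cV[R]_d) (Z : hist d N -> 'cV[R]_d) (k t : R) :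
  hE p Z = 0 -> hE p (fun h => Z h *m (Z h)^T) = k%:M ->
  \sum_h hprob p h * (\sum_i c i 0 * Z h i 0 + t) ^+ 2 = k * \sum_i c i 0 ^+ 2 + t ^+ 2.
Proof.
move=> Z0 Hk.
have p1 : \sum_(h : hist d N) hprob p h * 1 = 1 := @hE_const R d p d_gt0 N R^o 1.
have m0 : \sum_h hprob p h * (\sum_i c i 0 * Z h i 0) = 0.
  under eq_bigr do rewrite mulr_sumr.
  rewrite exchange_big/= big1// => i _.
  transitivity (c i 0 * (hE p Z) i 0); last by rewrite Z0 mxE mulr0.
  rewrite /hE summxE mulr_sumr; apply: eq_bigr => h _; rewrite mxE; ring.
transitivity (\sum_h hprob p h * (\sum_i c i 0 * Z h i 0) ^+ 2
  + 2 * t * (\sum_h hprob p h * (\sum_i c i 0 * Z h i 0))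
  + t ^+ 2 * \sum_(h : hist d N) hprob p h * 1); last first.
  by rewrite m0 p1 (hE_quad c Hk) mulr0 addr0 mulr1.
by rewrite !mulr_sumr -!big_split/=; apply: eq_bigr => h _; ring.
Qed.

End Asymptotics.

(** * Polarization of second moments *)

Section Polarization.
Context d (T : measurableType d) (R : realType) (P : probability T R).

Lemma integrable_sqr (u : T -> R) (k : R) : measurable_fun setT u ->
  (\int[P]_w (u w ^+ 2)%:E = k%:E)%E -> P.-integrable setT (fun w => (u w ^+ 2)%:E).
Proof.
move=> mu uk; apply/integrableP; split.
  by apply/measurable_EFinP; exact: measurable_funX.
under eq_integral do rewrite gee0_abs ?lee_fin ?sqr_ge0//.
by rewrite uk ltry.
Qed.

(** From [4 u v = (u + v)^2 - (u - v)^2]; both squares are nonnegative with finite integral, which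
    also gives integrability of the product. *)
Lemma polarization (u v : T -> R) (k l : R) :
  measurable_fun setT u -> measurable_fun setT v ->
  (\int[P]_w ((u w + v w) ^+ 2)%:E = k%:E)%E ->
  (\int[P]_w ((u w - v w) ^+ 2)%:E = l%:E)%E ->
  P.-integrable setT (fun w => (u w * v w)%:E) /\
  (\int[P]_w (u w * v w)%:E = ((k - l) / 4)%:E)%E.
Proof.
move=> mu mv uk ul.
have i1 := integrable_sqr (measurable_funD mu mv) uk.
have i2 := integrable_sqr (measurable_funB mu mv) ul.
have E w : (u w * v w)%:E = (4^-1%:E * (((u w + v w) ^+ 2)%:E - ((u w - v w) ^+ 2)%:E))%E.
  by rewrite -EFinB -EFinM; congr EFin; field.
under eq_integral do rewrite E.
have i3 := integrableB measurableT i1 i2.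
split; first by under eq_fun do rewrite E; exact: integrableZl.
by rewrite integralZl// integralB// uk ul -EFinB -EFinM mulrC.
Qed.

End Polarization.

(** * Second moments of affine forms of the limit *)

Section LimitMoments.
Context (R : realType) (d0 : measure_display) (T : measurableType d0).
Variables (P : probability T R) (d : nat) (p : R).
Variables (X : nat -> T -> 'cV[R]_d) (b : nat -> T -> nat) (A : nat -> T -> 'M[R]_d).
Variable L : T -> 'cV[R]_d.
Hypothesis d_gt0 : (0 < d)%N.
Hypothesis merw : is_MERW P p X b A.
Local Notation a := (drift d p).
Hypothesis a_bounds : 2^-1 < a <= 1.
Hypothesis mL : forall i : 'I_d, measurable_fun setT (fun w => L w i 0).
Hypothesis cvL : {ae P, forall w, forall i : 'I_d,
  (fun n : nat => (n%:R `^ (- a)) * Spos X n w i 0) @ \oo --> L w i 0}.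

Lemma limit_affine_sq (c : 'cV[R]_d) (t : R) :
  (\int[P]_w ((\sum_i c i 0 * L w i 0 + t) ^+ 2)%:E =
   (((2 * a - 1) * Gamma (2 * a))^-1 / d%:R * (\sum_i c i 0 ^+ 2) + t ^+ 2)%:E)%E.
Proof.
pose s n : R := n.+1%:R `^ (- a).
pose phi n (h : hist d n) : R := \sum_i c i 0 * (s n *: hS R h n.+1) i 0 + t.
pose f n := hsim X b A (phi n).
pose C := \sum_i c i 0 ^+ 2.
pose e n := s n ^+ 2 * varS d p n.
pose r n := s n * growth d p n.
pose g := (Gamma (1 + a))^-1.
have s0 n : s n != 0 by rewrite gt_eqF// powR_gt0.
have r0 n : r n != 0 by rewrite mulf_neq0// growth_neq0.
have /andP[a0 a1] := a_bounds.
have g0 : g != 0 by rewrite invr_eq0 gt_eqF// Gamma_gt0//; lra.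
(* [f n] is built on [hist d n]; reading it on longer histories places [f n] and [f (m + n)] on one
   finite space. *)
have fE n N (h : hist d N) w : (n <= N)%N -> hev X b A h w ->
    f n w = \sum_i c i 0 * (s n *: hS R h n.+1) i 0 + t.
  move=> nN hw; have [h' hw'] := hev_prefix hw nN.
  rewrite /f (hsimE _ hw') /phi.
  by rewrite -(hev_S merw hw' (leqnn _)) -(hev_S merw hw (_ : (n.+1 <= N.+1)%N)).
have mf n : measurable_fun setT (f n) by exact: (hsim_measurable merw).
have ce : e @ \oo --> ((2 * a - 1) * Gamma (2 * a))^-1 by exact: cvg_varS.
have cr : r @ \oo --> g by exact: cvg_growth.
(* [e] is the rescaled second moment and [r] the rescaled growth factor. The constant [t] drops out
   of differences, and the cross moment enters through the ratio [r (m + n) / r n], whose limit in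
   [m] is [g / r n]. *)
apply: (@L2_limit _ _ _ P f _ (fun n => e n / d%:R * C + t ^+ 2)
   (fun m n => (e (m + n)%N + e n - 2 * (r (m + n)%N / r n * e n)) / d%:R * C)
   (fun n => (((2 * a - 1) * Gamma (2 * a))^-1 + e n - 2 * (g / r n * e n)) / d%:R * C)) => //.
- apply: measurable_funD => //; apply: measurable_sum => i.
  exact: measurable_funM.
- have aeN : {ae P, forall w, forall n, exists h : hist d n, hev X b A h w}.
    by apply: ae_foralln => n; exact: (ae_hev merw d_gt0).
  apply: filterS2 cvL aeN => w cw hw.
  have fw n : f n w = \sum_i c i 0 * (s n * Spos X n.+1 w i 0) + t.
    have [h hw'] := hw n; rewrite (fE n n h)//; congr (_ + _); apply: eq_bigr => i _.
    by rewrite mxE (hev_S merw hw').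
  rewrite (funext fw); apply: cvgD; last exact: cvg_cst.
  apply: (cvg_big (op := +%R) (x0 := 0)) => [|i _]; first exact: add_continuous.
  apply: cvgM; first exact: cvg_cst.
  by have := cw i; rewrite -cvg_shiftS.
- move=> n.
  rewrite (integral_hist merw d_gt0 (phi := fun h => phi n h ^+ 2)); last 2 first.
  + exact: measurable_funX.
  + by move=> h w hw; rewrite (fE n n h).
  congr EFin; rewrite /phi (hE_affine_sq d_gt0 c t (k := e n / d%:R))//.
    by rewrite hEZ mean_S// scaler0.
  have := second_moment_diff d_gt0 a_bounds (s n) 0 (leqnn n).
  under eq_hE do rewrite scale0r subr0.
  by move=> ->; congr (_%:M); rewrite expr0n/= !mulr0 !mul0r subr0 addr0.
- move=> m n.
  pose Z (h : hist d (m + n)) := s (m + n)%N *: hS R h (m + n).+1 - s n *: hS R h n.+1.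
  rewrite (integral_hist merw d_gt0 (phi := fun h => (\sum_i c i 0 * Z h i 0) ^+ 2)); last 2 first.
  + by apply: measurable_funX; exact: measurable_funB.
  + move=> h w hw; rewrite (fE n _ h)//; last exact: leq_addl.
    rewrite (fE _ _ h)// /Z opprD addrACA subrr addr0 -sumrB; congr (_ ^+ 2).
    by apply: eq_bigr => i _; rewrite !mxE; ring.
  congr EFin; apply: hE_quad.
  rewrite second_moment_diff//; last exact: leq_addl.
  congr (_%:M); rewrite /e /r; field.
  by rewrite (growth_neq0 a_bounds) pnatr_eq0 -lt0n d_gt0 s0.
- apply: cvgD; last exact: cvg_cst.
  apply: cvgM; last exact: cvg_cst.
  by apply: cvgM => //; exact: cvg_cst.
- move=> n; apply: cvgM; last exact: cvg_cst.
  apply: cvgM; last exact: cvg_cst.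
  have ce' : e (m + n)%N @[m --> \oo] --> ((2 * a - 1) * Gamma (2 * a))^-1.
    by rewrite (cvg_shiftn n).
  have cr' : r (m + n)%N @[m --> \oo] --> g by rewrite (cvg_shiftn n).
  apply: cvgB; first by apply: cvgD => //; exact: cvg_cst.
  apply: cvgM; first exact: cvg_cst.
  apply: cvgM; last exact: cvg_cst.
  by apply: cvgM => //; exact: cvg_cst.
(* The limit is proportional to [E + E - 2 E = 0]: the Cauchy property in mean square. *)
- set E := ((2 * a - 1) * Gamma (2 * a))^-1.
  have -> : 0 = (E + E - 2 * (g / g * E)) / d%:R * C by rewrite mulfV//; ring.
  apply: cvgM; last exact: cvg_cst.
  apply: cvgM; last exact: cvg_cst.
  apply: cvgB; first by apply: cvgD => //; exact: cvg_cst.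
  apply: cvgM; first exact: cvg_cst.
  apply: cvgM => //.
  by apply: cvgM; [exact: cvg_cst | exact: cvgV].
Qed.

End LimitMoments.

Theorem theorem3p8 (R : realType) (d0 : measure_display) (T : measurableType d0)
  (P : probability T R) (d : nat) (p : R)
  (X : nat -> T -> 'cV[R]_d) (b : nat -> T -> nat) (A : nat -> T -> 'M[R]_d)
  (L : T -> 'cV[R]_d) :
  (1 <= d)%N ->
  (2 * d + 1)%:R / (4 * d)%:R < p -> p <= 1 ->
  is_MERW P p X b A ->
  let a := ((2 * d)%:R * p - 1) / (2 * d - 1)%:R in
  (forall i : 'I_d, measurable_fun setT (fun w => L w i 0)) ->
  {ae P, forall w, forall i : 'I_d,
      (fun n : nat => (n%:R `^ (- a)) * Spos X n w i 0) @ \oo --> L w i 0} ->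
  (* E[L] = 0 *)
  (forall i : 'I_d,
      P.-integrable setT (fun w => (L w i 0)%:E) /\
      (\int[P]_w (L w i 0)%:E = 0)%E) /\
  (* E[L L^T] = 1/(d(2a-1)Gamma(2a)) I_d *)
  (forall i j : 'I_d,
      P.-integrable setT (fun w => (L w i 0 * L w j 0)%:E) /\
      (\int[P]_w (L w i 0 * L w j 0)%:E
         = ((i == j)%:R / (d%:R * (2 * a - 1) * Gamma (2 * a)))%:E)%E) /\
  (* E[||L||^2] = 1/((2a-1)Gamma(2a)) *)
  (\int[P]_w (\sum_(i < d) L w i 0 ^+ 2)%:E
     = (1 / ((2 * a - 1) * Gamma (2 * a)))%:E)%E.
Proof.
move=> d_gt0 pl p1 merw a mL cvL.
(* The condition [p > (2 d + 1) / (4 d)] amounts to [a > 1/2], and [p <= 1] to [a <= 1]. *)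
have a_bounds : 2^-1 < drift d p <= 1.
  have := pred_double_natr R d_gt0; rewrite /drift.
  have -> : (2 * d)%:R = 2 * d.-1%:R + 2 :> R by rewrite -natrM -natrD; congr (_%:R); lia.
  move=> ->.
  have : p * (4 * d.-1%:R + 4) > 2 * d.-1%:R + 3.
    move: pl; rewrite ltr_pdivrMr ?ltr0n; last by lia.
    have -> : (4 * d)%:R = 4 * d.-1%:R + 4 :> R by rewrite -natrM -natrD; congr (_%:R); lia.
    by have -> : (2 * d + 1)%:R = 2 * d.-1%:R + 3 :> R
      by rewrite -natrM -natrD; congr (_%:R); lia.
  have := ler0n R d.-1; move: (d.-1%:R) => x x0 px.
  rewrite ltr_pdivlMr ?ler_pdivrMr; [|lra..].
  by apply/andP; split; nra.
have key := limit_affine_sq d_gt0 merw a_bounds mL cvL.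
rewrite -/a in key.
set K := ((2 * a - 1) * Gamma (2 * a))^-1 / d%:R in key.
have dn0 : d%:R != 0 :> R by rewrite pnatr_eq0 -lt0n.
(* The column is [e_i + s e_j]. The case [i = j] is allowed, with entry [1 + s]; the term
   [2 s (i == j)] of its squared norm accounts for it. *)
have linE (i j : 'I_d) (s : R) w :
    \sum_k (\col_k ((k == i)%:R + s * (k == j)%:R)) k 0 * L w k 0 = L w i 0 + s * L w j 0.
  rewrite (eq_bigr (fun k => (k == i)%:R * L w k 0 + s * ((k == j)%:R * L w k 0))).
    rewrite big_split/= -mulr_sumr; congr (_ + _ * _).
      by rewrite (bigD1 i)//= eqxx mul1r big1 ?addr0// => k /negbTE ->; rewrite mul0r.
    by rewrite (bigD1 j)//= eqxx mul1r big1 ?addr0// => k /negbTE ->; rewrite mul0r.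
  by move=> k _; rewrite mxE mulrDl mulrA.
have sqE (i j : 'I_d) (s : R) :
    \sum_k (\col_k ((k == i)%:R + s * (k == j)%:R)) k 0 ^+ 2
    = 1 + s ^+ 2 + 2 * s * (i == j)%:R :> R.
  rewrite (eq_bigr (fun k => (k == i)%:R + s ^+ 2 * (k == j)%:R
      + 2 * s * ((k == i)%:R * (i == j)%:R))).
    have one (l : 'I_d) : \sum_k (k == l)%:R = 1 :> R.
      by rewrite (bigD1 l)//= eqxx big1 ?addr0// => k /negbTE ->.
    by rewrite !big_split/= -!mulr_sumr -mulr_suml !one mul1r mulr1.
  move=> k _; rewrite mxE; have [->|_] := eqVneq k i.
    by case: (i == j) => /=; ring.
  by case: (k == j) => /=; ring.
have pair (i j : 'I_d) (s t : R) :
    (\int[P]_w ((L w i 0 + s * L w j 0 + t) ^+ 2)%:E =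
     (K * (1 + s ^+ 2 + 2 * s * (i == j)%:R) + t ^+ 2)%:E)%E.
  rewrite -(sqE i j s) -key; apply: eq_integral => w _.
  by rewrite linE.
have cov (i j : 'I_d) : P.-integrable setT (fun w => (L w i 0 * L w j 0)%:E) /\
    (\int[P]_w (L w i 0 * L w j 0)%:E = (K * (i == j)%:R)%:E)%E.
  (* The weights [s = 1] and [s = -1] with [t = 0] give the squares of the sum and of the
     difference. *)
  have := @polarization _ _ R P (fun w => L w i 0) (fun w => L w j 0)
    (K * (2 + 2 * (i == j)%:R)) (K * (2 - 2 * (i == j)%:R)) (mL i) (mL j).
  have -> : (K * (2 + 2 * (i == j)%:R) - K * (2 - 2 * (i == j)%:R)) / 4 = K * (i == j)%:R.
    by field.
  apply.
  - transitivity (\int[P]_w ((L w i 0 + 1 * L w j 0 + 0) ^+ 2)%:E)%E.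
      by apply: eq_integral => w _; rewrite mul1r addr0.
    by rewrite pair; congr EFin; ring.
  - transitivity (\int[P]_w ((L w i 0 + (-1) * L w j 0 + 0) ^+ 2)%:E)%E.
      by apply: eq_integral => w _; rewrite mulN1r addr0.
    by rewrite pair; congr EFin; ring.
split; [|split].
- move=> i.
  (* Both [E[(L_i + 1)^2]] and [E[(L_i - 1)^2]] equal [K + 1], so their difference, four times the
     mean, is [0]. *)
  have := @polarization _ _ R P (fun w => L w i 0) (fun=> 1) (K + 1) (K + 1) (mL i).
  have -> : (fun w => (L w i 0 * 1)%:E) = (fun w => (L w i 0)%:E).
    by apply/funext => w; rewrite mulr1.
  rewrite subrr mul0r; apply; first exact: measurable_cst.
  - transitivity (\int[P]_w ((L w i 0 + 0 * L w i 0 + 1) ^+ 2)%:E)%E.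
      by apply: eq_integral => w _; rewrite mul0r addr0.
    by rewrite pair; congr EFin; ring.
  - transitivity (\int[P]_w ((L w i 0 + 0 * L w i 0 + (- 1)) ^+ 2)%:E)%E.
      by apply: eq_integral => w _; rewrite mul0r addr0.
    by rewrite pair; congr EFin; ring.
- move=> i j; have [ij ->] := cov i j; split => //; congr EFin.
  by rewrite /K -!invfM mulrC [d%:R * _]mulrC mulrAC.
(* Trace of the covariance: [d] equal terms [K] absorb the factor [1 / d] in [K]. *)
- under eq_integral do rewrite -sumEFin.
  rewrite integral_sum//; last by move=> i; under eq_fun do rewrite expr2; exact: (cov i i).1.
  rewrite (eq_bigr (fun=> K%:E)); last first.
    by move=> i _; under eq_integral do rewrite expr2; rewrite (cov i i).2 eqxx mulr1.
  rewrite sumEFin sumr_const card_ord; congr EFin.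
  by rewrite -[_ *+ _]mulr_natr /K divfK// mul1r.
Qed.
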